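(* Let $p\in\mathcal{P}$. The following are equivalent. (i) The limit $\lim_{k\rightarrow\infty}elo_k(p)$ exists in $\mathcal{R}$. (ii) For all $k>0$, the limit $\lim_{l\rightarrow\infty}elo_k(l\cdot p)$ exists in $\mathcal{R}$. (iii) The set $\{elo_k(p)\mid k>0\}\subseteq\mathcal{R}$ is bounded. (iv) There exists an element $x\in\mathcal{R}$ with $elo_1^{cl}(x,p)=0$. (v) All connected components of $p$ are strongly connected. Moreover, the following hold true. (vi) If the equivalent conditions (i)--(v) are satisfied, then the limits in (i) and (ii) (the latter for every $k>0$) coincide, and their common value $x$ satisfies $elo_1^{cl}(x,p)=0$. (vii) If $p$ is weakly connected, then there exists at most one element $x\in\mathcal{R}$ with $elo_1^{cl}(x,p)=0$.
   Context: Fix $n\in\mathbb{N}$ with $n\geq 2$ and identify $n=\{0,1,\dots,n-1\}$ (so $i\in n$ means $0\le i\le n-1$). The rating space is $\mathcal{R}:=\{x\in\mathbb{R}^n\mid\sum_{i\in n}x_i=0\}$, with norm $\lVert\cdot\rVert_1$. The space of competition results is $\mathcal{P}:=\{p\in\mathbb{R}^{n\times n}\mid p_{ij}\geq 0\text{ for all }i,j\in n,\ p_{ii}=0\text{ for all }i\in n\}$. For $k>0$, the classical Elo map is $$elo_k^{cl}:\mathcal{R}\times\mathcal{P}\rightarrow\mathcal{R},\quad (x,p)\mapsto k\cdot\left(\sum_{j\in n}\left(p_{ij}-\frac{p_{ij}+p_{ji}}{1+\exp(x_j-x_i)}\right)\right)_{i\in n}.$$ For every $k>0$ and $p\in\mathcal{P}$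 there is exactly one $x\in\mathcal{R}$ with $x=elo_k^{cl}(x,p)$; it is denoted $elo_k(p)$ (the self-justifying rating with respect to $p$ and $k$). In limits $k\to\infty$ and $l\to\infty$, the variables $k$ and $l$ range over the positive reals. The result graph of $p\in\mathcal{P}$ is the directed graph with vertex set $n$ and an edge from $i$ to $j$ whenever $p_{ij}>0$. $p$ is weakly connected if its result graph is weakly connected, i.e. for every $i,j\in n$ there is a not necessarily directed path from $i$ to $j$. The connected components of $p$ are the vertex sets $t\subseteq n$ of the maximal weakly connected subgraphs of the result graph. A connected component $t$ of $p$ is strongly connected if the subgraph of the result graph on the vertex set $t$ is strongly connected, i.e. for every $i,j\in t$ there is a directed path from $i$ to $j$ in it (paths of length $0$ allowed, so a single vertex is strongly connected). *)

(* Defs.v *)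
From HB Require Import structures.
From mathcomp Require Import all_boot all_order all_algebra.
From mathcomp Require Import all_classical all_reals all_analysis.

Set Implicit Arguments.
Unset Strict Implicit.
Unset Printing Implicit Defensive.

Import Order.TTheory GRing.Theory Num.Theory.
Import numFieldNormedType.Exports.

Local Open Scope classical_set_scope.
Local Open Scope ring_scope.

Section Elo.
Context {R : realType} {n : nat}.
Implicit Types (k : R) (x : 'rV[R]_n) (p : 'M[R]_n) (t : {set 'I_n}).

Definition rating : set 'rV[R]_n := [set x | \sum_i x 0 i = 0].

(* The library norm on 'rV[R]_n is the sup norm, hence this definition. *)
Definition norm1 x : R := \sum_i `|x 0 i|.

Definition competition : set 'M[R]_n :=
  [set p | (forall i j, 0 <= p i j) /\ (forall i, p i i = 0)].

Definition elo_cl k x p : 'rV[R]_n :=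
  k *: \row_i \sum_j (p i j - (p i j + p j i) / (1 + expR (x 0 j - x 0 i))).

(* For 0 < k and p in competition the set below is a singleton, so that elo k p
   is its unique element; outside this range the value is irrelevant. *)
Definition elo k p : 'rV[R]_n :=
  xget 0 [set x | rating x /\ x = elo_cl k x p].

(* f tends to x at infinity, in the normed space (rating, norm1). *)
Definition rating_lim (f : R -> 'rV[R]_n) x : Prop :=
  rating x /\ norm1 (f k - x) @[k --> +oo] --> (0 : R).

Definition edge p : rel 'I_n := [rel i j | 0 < p i j].

(* Induced subgraph of the result graph on the vertex set t. *)
Definition edge_in p t : rel 'I_n :=
  [rel i j | [&& i \in t, j \in t & edge p i j]].

Definition strongly_connected_on p t : bool :=
  [forall i in t, forall j in t, connect (edge_in p t) i j].

Definition weakly_connected_on p t : bool :=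
  [forall i in t, forall j in t,
     connect [rel a b | edge_in p t a b || edge_in p t b a] i j].

Definition weakly_connected p : bool := weakly_connected_on p [set: 'I_n]%SET.

(* The empty set is weakly connected in the above sense, but it is not maximal
   as soon as 0 < n. *)
Definition component p t : bool := maxset (weakly_connected_on p) t.

End Elo.

(* Main.v *)
Require Import Defs.
From HB Require Import structures.
From mathcomp Require Import all_boot all_order all_algebra.
From mathcomp Require Import all_classical all_reals all_analysis.
From mathcomp Require Import ring lra.

Set Implicit Arguments.
Unset Strict Implicit.
Unset Printing Implicit Defensive.

Import Order.TTheory GRing.Theory Num.Theory.
Import numFieldNormedType.Exports.

Local Open Scope classical_set_scope.
Local Open Scope ring_scope.

(* The map [elo_cl 1 _ p] is minus the gradient of the convex potential
   [sum_ij p i j * softplus (x j - x i)], so [elo k p] minimises [k] times this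
   potential plus half of the squared Euclidean norm, and [elo_cl 1 _ p] is
   antitone for the Euclidean scalar product.
   - Antitonicity gives [|elo k p - elo l p|^2 <= |elo k p|^2 - |elo l p|^2] for
     [l <= k].  Hence a bounded family is Cauchy as [k] grows, and its limit is a
     zero since [elo_cl 1 (elo k p) p = k^-1 *: elo k p].  Antitonicity also
     bounds the norm of [elo k p] by that of any zero.
   - At a zero, the weights [flow p x i j], positive exactly on the edges, form a
     circulation, so every edge lies on a directed cycle.
   - The potential at [elo k p] is at most that at [0], which bounds
     [elo k p j - elo k p i] from above along each edge from [i] to [j], hence in
     absolute value on strongly connected components; the coordinates of
     [elo k p] sum to [0] on each component, so they are bounded. *)

Section EloTheory.
Context {R : realType} {n : nat}.
Implicit Types (d k l t : R) (p : 'M[R]_n) (x y u v : 'rV[R]_n).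

(** * The logistic win probability and softplus *)

Definition win d : R := (1 + expR d)^-1.

Lemma win_den_gt0 d : 0 < 1 + expR d.
Proof. by rewrite addr_gt0// expR_gt0. Qed.

Lemma win_gt0 d : 0 < win d.
Proof. by rewrite invr_gt0 win_den_gt0. Qed.

Lemma winN d : win (- d) = 1 - win d.
Proof.
have := expR_gt0 d; rewrite /win expRN => e0.
by field; rewrite !gt_eqF// ?addr_gt0.
Qed.

(** The product is symmetric in [d] and [e], so [d < e] may be assumed. The equality case is what
    later yields uniqueness of zeros. *)
Lemma win_decr d e : (win d - win e) * (d - e) <= 0 ?= iff (d == e).
Proof.
wlog de : d e / d < e.
  move=> H; have [de|ed|->] := ltgtP d e.
  - by have := H _ _ de; rewrite lt_eqF.
  - by have := H _ _ ed; rewrite lt_eqF// -mulrNN !opprB.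
  - by rewrite subrr mul0r; exact/leif_refl.
have lt0 : (win d - win e) * (d - e) < 0.
  rewrite nmulr_llt0 ?subr_lt0// subr_gt0.
  by rewrite ltf_pV2 ?posrE ?win_den_gt0// ltrD2l ltr_expR.
by split; rewrite ?(ltW lt0)// lt_eqF// lt_eqF.
Qed.

Lemma continuous_win : continuous win.
Proof.
move=> d; apply: cvgV; first by rewrite gt_eqF// win_den_gt0.
by apply: cvgD; [exact: cvg_cst|exact: continuous_expR].
Qed.

Definition softplus t : R := ln (1 + expR t).

Lemma softplus_ge0 t : 0 <= softplus t.
Proof. by rewrite ln_ge0// lerDl expR_ge0. Qed.

Lemma softplus_ge t : t <= softplus t.
Proof.
by rewrite -[leLHS]expRK ler_ln ?posrE ?expR_gt0 ?win_den_gt0// lerDr.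
Qed.

Lemma is_derive_softplus t : is_derive t 1 softplus (win (- t)).
Proof.
have w0 := win_den_gt0 t.
have dln := is_derive1_ln w0.
have -> : softplus = @ln R \o (cst 1 + expR) by [].
apply: is_derive_eq; rewrite winN /win add0r.
by field; rewrite gt_eqF.
Qed.

Lemma continuous_softplus : continuous softplus.
Proof.
move=> t; apply: differentiable_continuous; apply/derivable1_diffP.
by have [] := is_derive_softplus t.
Qed.

(** * Euclidean scalar product *)

Definition dot u v : R := \sum_i u 0 i * v 0 i.

Lemma dotC u v : dot u v = dot v u.
Proof. by apply: eq_bigr => i _; rewrite mulrC. Qed.

Lemma dotDl u v y : dot (u + v) y = dot u y + dot v y.
Proof. by rewrite -big_split; apply: eq_bigr => i _; rewrite mxE mulrDl. Qed.

Lemma dotZl k u v : dot (k *: u) v = k * dot u v.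
Proof. by rewrite mulr_sumr; apply: eq_bigr => i _; rewrite mxE mulrA. Qed.

Lemma dotBl u v y : dot (u - v) y = dot u y - dot v y.
Proof. by rewrite dotDl -scaleN1r dotZl mulN1r. Qed.

Lemma dotBr y u v : dot y (u - v) = dot y u - dot y v.
Proof. by rewrite dotC dotBl !(dotC y). Qed.

Lemma dotZr k u v : dot u (k *: v) = k * dot u v.
Proof. by rewrite dotC dotZl dotC. Qed.

Lemma coord_le_dot u i : u 0 i ^+ 2 <= dot u u.
Proof.
rewrite /dot (bigD1 i)//= expr2 lerDl sumr_ge0// => j _.
by rewrite -expr2 sqr_ge0.
Qed.

Lemma dot_ge0 u : 0 <= dot u u.
Proof. by rewrite sumr_ge0// => j _; rewrite -expr2 sqr_ge0. Qed.

Lemma dot_eq0 u : dot u u <= 0 -> u = 0.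
Proof.
move=> u0; apply/rowP => i; rewrite mxE; apply/eqP; rewrite -sqrf_eq0.
by rewrite eq_le sqr_ge0 (le_trans (coord_le_dot u i) u0).
Qed.

(** * The Elo map as the divergence of a flow *)

Definition flow p x i j : R := p i j * win (x 0 i - x 0 j).

Lemma elo_cl_scale k x p : elo_cl k x p = k *: elo_cl 1 x p.
Proof. by rewrite /elo_cl scale1r. Qed.

(** Since [win d] and [win (- d)] add up to 1, each summand splits into a flow out of [i] minus a
    flow into [i]. *)
Lemma elo_cl1E x p i :
  elo_cl 1 x p 0 i = \sum_j (flow p x i j - flow p x j i).
Proof.
rewrite /elo_cl scale1r mxE; apply: eq_bigr => j _; rewrite /flow.
by rewrite -[x 0 i - x 0 j]opprB winN -/(win _); ring.
Qed.

(** Summation by parts: exchanging the indices in the inflow moves the divergence onto [u].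
    Indicator vectors [u] then measure flow across cuts. *)
Lemma dot_elo_cl x p u :
  dot u (elo_cl 1 x p) = \sum_i \sum_j flow p x i j * (u 0 i - u 0 j).
Proof.
rewrite /dot.
under eq_bigr do rewrite elo_cl1E sumrB mulrBr !mulr_sumr.
rewrite sumrB [X in _ - X]exchange_big -sumrB; apply: eq_bigr => i _.
by rewrite -sumrB; apply: eq_bigr => j _; ring.
Qed.

Lemma elo_cl_scalep k l x p : elo_cl k x (l *: p) = elo_cl (k * l) x p.
Proof.
rewrite /elo_cl -scalerA; congr (_ *: _); apply/rowP => i; rewrite !mxE.
by rewrite mulr_sumr; apply: eq_bigr => j _; rewrite !mxE; ring.
Qed.

Lemma sum_elo_cl k x p : \sum_i elo_cl k x p 0 i = 0.
Proof.
under eq_bigr do rewrite elo_cl_scale mxE.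
rewrite -mulr_sumr.
have -> : \sum_i elo_cl 1 x p 0 i = dot (const_mx 1) (elo_cl 1 x p).
  by apply: eq_bigr => i _; rewrite [const_mx _ _ _]mxE mul1r.
rewrite dot_elo_cl big1 ?mulr0// => i _; rewrite big1// => j _.
by rewrite !mxE subrr mulr0.
Qed.

(** Summation by parts turns the left side into a sum of terms as in [win_decr], weighted by
    [p i j]. Terms of weight 0 impose no equality, hence the implication. *)
Lemma elo_cl_antitone p x y : competition p ->
  dot (elo_cl 1 x p - elo_cl 1 y p) (x - y) <= 0 ?=
  iff [forall i, forall j, (0 < p i j) ==> (x 0 i - x 0 j == y 0 i - y 0 j)].
Proof.
move=> [p0 _].
pose W i j := (win (x 0 i - x 0 j) - win (y 0 i - y 0 j)) *
  ((x 0 i - x 0 j) - (y 0 i - y 0 j)).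
rewrite dotC dotBr !dot_elo_cl -sumrB.
under eq_bigr => i _ do rewrite -sumrB.
under eq_bigr => i _.
  under eq_bigr => j _.
    rewrite (_ : _ - _ = p i j * W i j); last by rewrite /flow /W !mxE; ring.
    over.
  over.
have H i j : p i j * W i j <= 0
   ?= iff ((0 < p i j) ==> (x 0 i - x 0 j == y 0 i - y 0 j)).
  have [pij|] := boolP (0 < p i j) => /=.
    have := win_decr (x 0 i - x 0 j) (y 0 i - y 0 j).
    by rewrite -(mono_leif (ler_pM2l pij)) mulr0.
  rewrite -leNgt => pij; have -> : p i j = 0 by apply/eqP; rewrite eq_le pij p0.
  by rewrite mul0r; exact/leif_refl.
have H1 i : \sum_j p i j * W i j <= 0
    ?= iff [forall j, (0 < p i j) ==> (x 0 i - x 0 j == y 0 i - y 0 j)].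
  by have := leif_sum (fun j (_ : true) => H i j); rewrite big1_eq.
by have := leif_sum (fun j (_ : true) => H1 j); rewrite big1_eq.
Qed.

(** * Existence and uniqueness of the fixed point by minimising the energy *)

Definition energy k p x : R :=
  2^-1 * dot x x + k * \sum_i \sum_j p i j * softplus (x 0 j - x 0 i).

Lemma cvg_sum {T I : Type} (F : set_system T) {FF : Filter F} (r : seq I)
    (f : I -> T -> R) (a : I -> R) :
  (forall i, f i t @[t --> F] --> a i) ->
  \sum_(i <- r) f i t @[t --> F] --> \sum_(i <- r) a i.
Proof. by move=> fa; apply: cvg_big => //; exact: add_continuous. Qed.

Lemma cvg_energy {T : Type} (F : set_system T) {FF : Filter F} k p
    (f : T -> 'rV[R]_n) x :
  (forall i, f t 0 i @[t --> F] --> x 0 i) ->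
  energy k p (f t) @[t --> F] --> energy k p x.
Proof.
move=> fx; apply: cvgD; apply: cvgM; try exact: cvg_cst.
  by apply: cvg_sum => i; exact: cvgM.
apply: cvg_sum => i; apply: cvg_sum => j; apply: cvgM; first exact: cvg_cst.
apply: (@cvg_comp _ _ _ _ softplus); last exact: continuous_softplus.
by apply: cvgB.
Qed.

Lemma continuous_energy k p : continuous (energy k p).
Proof.
move=> x; apply: (@cvg_energy _ (nbhs x) (nbhs_filter x) k p id) => i.
exact: coord_continuous.
Qed.

(** The softplus terms are nonnegative, so the energy dominates its quadratic term, and a minimum
    over a large enough box is global. *)
Lemma energy_min_exists k p : 0 < k -> competition p ->
  exists x, forall y, energy k p x <= energy k p y.
Proof.
move=> k0 [p0 _].
have sum_ge0 y : 0 <= k * \sum_i \sum_j p i j * softplus (y 0 j - y 0 i).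
  apply: mulr_ge0; first exact: ltW.
  apply: sumr_ge0 => i _; apply: sumr_ge0 => j _.
  by rewrite mulr_ge0 ?softplus_ge0.
have energy_ge y i : y 0 i ^+ 2 <= 2 * energy k p y.
  by have := coord_le_dot y i; have := sum_ge0 y; rewrite /energy; lra.
(* Any nonnegative [M] with [2 * energy k p 0 <= M ^+ 2] would do; this one avoids a square root. *)
pose M := 1 + 2 * energy k p 0.
have E0 : 0 <= energy k p 0.
  by have := sum_ge0 0; have := dot_ge0 (0 : 'rV[R]_n); rewrite /energy; lra.
pose A := [set v : 'rV[R]_n | forall i, `[- M, M]%classic (v ord0 i)].
have Acompact : compact A.
  apply: (@rV_compact _ _ (fun=> `[- M, M]%classic)) => i.
  exact: segment_compact.
have A0 : A 0 by move=> i; rewrite /= mxE in_itv/= /M; apply/andP; split; lra.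
have Ec : {within A, continuous (energy k p)}.
  by apply/continuous_subspaceT; exact: continuous_energy.
have [x xA xmin] := EVT_min_rV (ex_intro _ _ A0) Acompact Ec.
exists x => y; have [yA|nyA] := pselect (A y); first by rewrite xmin ?inE.
apply: (@le_trans _ _ (energy k p 0)); first by rewrite xmin ?inE.
rewrite leNgt; apply/negP => yE; apply: nyA => i.
rewrite /= in_itv/= -ler_norml -(@ler_pXn2r _ 2)// ?nnegrE ?normr_ge0//;
  last by rewrite /M; lra.
rewrite real_normK ?num_real//; apply: le_trans (energy_ge _ _) _.
by rewrite /M; nra.
Qed.

(** The gradient of the energy is [x - elo_cl k x p]; restricting to lines keeps the calculus in one
    variable. *)
Lemma is_derive_energy k p x u t :
  is_derive t 1 (fun s => energy k p (x + s *: u))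
    (dot u (x + t *: u - elo_cl k (x + t *: u) p)).
Proof.
(* In this point-free form the derivative is inferred from instances. *)
have -> : (fun s => energy k p (x + s *: u)) =
  (2^-1 \*: \sum_i (cst (x 0 i) + u 0 i \*: id) ^+ 2)
   + k \*: \sum_i \sum_j p i j \*:
    (softplus \o ((cst (x 0 j) + u 0 j \*: id) - (cst (x 0 i) + u 0 i \*: id))).
  apply/funext => s; rewrite /energy !fctE !fct_sumE; congr (_ * _ + _ * _).
    by apply: eq_bigr => i _; rewrite !fctE !mxE expr2 mulrC (mulrC s).
  apply: eq_bigr => i _; rewrite fct_sumE; apply: eq_bigr => j _.
  by rewrite !fctE/= !mxE !(mulrC s).
have ds s := is_derive_softplus s.
apply: is_derive_eq.
rewrite dotBr elo_cl_scale dotZr dot_elo_cl -mulrN -sumrN; congr (_ + _ * _).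
  rewrite /dot -[_ *: _]/(_ * _) mulr_sumr; apply: eq_bigr => i _.
  rewrite !fctE/= !mxE expr1 -[_ *: _]/(_ * _) -[_%:A]/(_ * _).
  by rewrite -[_ *: _]/(_ * _); field.
apply: eq_bigr => i _; rewrite -sumrN; apply: eq_bigr => j _.
rewrite !fctE/= /flow !mxE -[_ *: _]/(_ * _) -![_%:A]/(_ * _) opprB.
rewrite -![_ *: _]/(_ * _) !(mulrC t); ring.
Qed.

(** In the direction of the gradient itself, the derivative at the minimiser is the squared norm of
    the gradient, and it must vanish. *)
Lemma min_fixpoint k p x : (forall y, energy k p x <= energy k p y) ->
  x = elo_cl k x p.
Proof.
move=> xmin; set u := x - elo_cl k x p.
have D t := is_derive_energy k p x u t.
have : is_derive (0 : R) (1 : R) (fun s => energy k p (x + s *: u)) 0.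
  apply: (@derive1_at_min _ _ (-1 : R) 1) => //.
  - by rewrite in_itv/=; apply/andP; split; lra.
  - by move=> t _; rewrite scale0r addr0.
move=> [_ D0]; have [_] := D 0; rewrite D0 scale0r addr0 => /esym u0.
by apply/eqP; rewrite -subr_eq0; apply/eqP/dot_eq0; rewrite u0.
Qed.

(** The squared distance is [k] times the pairing of [elo_cl_antitone], hence nonpositive. *)
Lemma fixpoint_unique k p x y : 0 < k -> competition p ->
  x = elo_cl k x p -> y = elo_cl k y p -> x = y.
Proof.
move=> k0 cp xE yE; apply/eqP; rewrite -subr_eq0; apply/eqP/dot_eq0.
rewrite {1}xE {1}yE !(elo_cl_scale k) -scalerBr dotZl pmulr_rle0//.
exact: elo_cl_antitone.
Qed.

(** The set behind [xget] is inhabited: the minimiser is a fixed point, and values of [elo_cl] have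
    coordinate sum 0. *)
Lemma eloP k p : 0 < k -> competition p -> elo k p = elo_cl k (elo k p) p.
Proof.
move=> k0 cp.
have [x /min_fixpoint xE] := energy_min_exists k0 cp.
have [] // : [set x | rating x /\ x = elo_cl k x p] (elo k p).
by apply: xgetPex; exists x; split=> //; rewrite /rating/= xE sum_elo_cl.
Qed.

Lemma elo_rating k p : 0 < k -> competition p -> rating (elo k p).
Proof. by move=> k0 cp; rewrite /rating/= eloP// sum_elo_cl. Qed.

Lemma energy_elo_min k p y : 0 < k -> competition p ->
  energy k p (elo k p) <= energy k p y.
Proof.
move=> k0 cp; have [x xmin] := energy_min_exists k0 cp.
by rewrite (fixpoint_unique k0 cp (eloP k0 cp) (min_fixpoint xmin)).
Qed.

(** * Dependence of [elo] on [k] and norm estimates *)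

Lemma elo_scalep k l p : elo k (l *: p) = elo (k * l) p.
Proof.
by congr xget; apply/funext => x /=; rewrite elo_cl_scalep.
Qed.

Lemma dot_elo k p u : 0 < k -> competition p ->
  dot u (elo k p) = k * dot u (elo_cl 1 (elo k p) p).
Proof. by move=> k0 cp; rewrite {1}eloP// elo_cl_scale dotZr. Qed.

Lemma dist_elo k l p : 0 < l -> l <= k -> competition p ->
  dot (elo k p - elo l p) (elo k p - elo l p) <=
  dot (elo k p) (elo k p) - dot (elo l p) (elo l p).
Proof.
move=> l0; rewrite le_eqVlt => /predU1P[<- _|lk cp].
  by rewrite !subrr /dot big1// => i _; rewrite !mxE mul0r.
have k0 : 0 < k by exact: lt_trans lk.
have [] := elo_cl_antitone (elo k p) (elo l p) cp.
have := dot_ge0 (elo k p - elo l p).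
set G := elo_cl 1 (elo k p) p; set H := elo_cl 1 (elo l p) p.
have -> : elo k p = k *: G by rewrite -elo_cl_scale -eloP.
have -> : elo l p = l *: H by rewrite -elo_cl_scale -eloP.
(* The bodies of [G] and [H] mention [elo], so the rewrites below would loop. *)
move: G H => G H.
rewrite !dotBl !dotBr !dotZl !dotZr (dotC H G).
set a := dot G G; set b := dot G H; set c := dot H H => norm mono _.
(* Expanding the squares leaves this inequality times [2 * l]. The quantity in [norm] minus the one
   in [kmono] is [(k - l) * (k * b - l * c)]. *)
suff : 0 <= k * b - l * c by nra.
have kmono : k * (k * a - l * b - (k * b - l * c)) <= 0 by rewrite pmulr_rle0.
by rewrite -(@pmulr_rge0 _ (k - l)) ?subr_gt0//; lra.
Qed.

(** Antitonicity against the zero [x] puts [elo k p] in the ball having the segment from [0] to [x]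
    as a diameter. *)
Lemma elo_le_zero k p x : 0 < k -> competition p -> elo_cl 1 x p = 0 ->
  dot (elo k p) (elo k p) <= dot x x.
Proof.
move=> k0 cp x0.
have [mono _] := elo_cl_antitone (elo k p) x cp.
have := dot_ge0 (elo k p - x).
have : dot (elo k p - x) (elo k p) <= 0.
  by rewrite dot_elo// dotC pmulr_rle0//; move: mono; rewrite x0 subr0.
rewrite !dotBl !dotBr (dotC x); lra.
Qed.

(** * Limits as [k] grows *)

Lemma coord_le_norm1 x i : `|x 0 i| <= norm1 x.
Proof. by rewrite /norm1 (bigD1 i)//= lerDl sumr_ge0. Qed.

Lemma rating_limP (f : R -> 'rV[R]_n) x :
  rating_lim f x <-> rating x /\ forall i, f k 0 i @[k --> +oo] --> x 0 i.
Proof.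
split=> -[rx fx]; split=> //.
  move=> i; apply/cvgrPdist_le => e e0.
  move/cvgr0Pnorm_le : fx => /(_ _ e0); apply: filterS => k.
  rewrite ger0_norm ?sumr_ge0//; apply: le_trans; rewrite distrC.
  by have := coord_le_norm1 (f k - x) i; rewrite !mxE.
have -> : (0 : R) = \sum_(i < n) `|x 0 i - x 0 i|.
  by rewrite big1// => i _; rewrite subrr normr0.
apply: cvg_sum => i; apply: cvg_norm.
under eq_fun do rewrite !mxE.
by apply: cvgB => //; exact: cvg_cst.
Qed.

Lemma cvg_elo_cl {T : Type} (F : set_system T) {FF : Filter F} p
    (f : T -> 'rV[R]_n) x i :
  (forall i, f t 0 i @[t --> F] --> x 0 i) ->
  elo_cl 1 (f t) p 0 i @[t --> F] --> elo_cl 1 x p 0 i.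
Proof.
move=> fx; under eq_fun do rewrite elo_cl1E; rewrite elo_cl1E.
have cf a b : flow p (f t) a b @[t --> F] --> flow p x a b.
  apply: cvgM; first exact: cvg_cst.
  apply: (@cvg_comp _ _ _ _ win); last exact: continuous_win.
  by apply: cvgB.
by apply: cvg_sum => j; apply: cvgB.
Qed.

Lemma elo_lim_zero p x : competition p ->
  rating_lim (fun k => elo k p) x -> elo_cl 1 x p = 0.
Proof.
move=> cp /rating_limP[_ zx]; apply/rowP => i; rewrite [RHS]mxE.
have cF : elo_cl 1 (elo k p) p 0 i @[k --> +oo] --> elo_cl 1 x p 0 i.
  exact: cvg_elo_cl.
apply: (cvg_unique (@Rhausdorff R) cF).
(* The zero is written as the limit of the product of [k^-1] and [elo k p 0 i], which is the Elo map
   at [elo k p]. *)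
have -> : (0 : R) = 0 * x 0 i by rewrite mul0r.
have : k^-1 * elo k p 0 i @[k --> +oo] --> 0 * x 0 i.
  apply: cvgM; last exact: zx.
  by apply/gtr0_cvgV0; [exact: nbhs_pinfty_gt|exact: cvg_id].
apply: cvg_trans; apply: near_eq_cvg.
near=> k; have k0 : 0 < k by near: k; exact: nbhs_pinfty_gt.
by rewrite [in LHS]eloP// elo_cl_scale mxE mulKf// gt_eqF.
Unshelve. all: by end_near. Qed.

Lemma elo_bounded_cvg p M : competition p ->
  (forall k, 0 < k -> norm1 (elo k p) <= M) ->
  exists x, rating_lim (fun k => elo k p) x.
Proof.
move=> cp zM.
pose N k := dot (elo k p) (elo k p).
pose E := [set N k | k in [set k | 0 < k]].
have supE : has_sup E.
  split; first by exists (N 1), 1 => //=.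
  exists (\sum_(i < n) M * M) => _ [k /= k0 <-]; apply: ler_sum => i _.
  have le := le_trans (coord_le_norm1 (elo k p) i) (zM _ k0).
  by rewrite (le_trans (ler_norm _))// normrM ler_pM.
have cv i : cvg (elo k p 0 i @[k --> +oo]).
  apply/cauchy_cvgP/cauchy_exP => e e0.
  (* By [dist_elo], the squared distance from [elo l p] to any later [elo k p] is at most
     [sup E - N l], so [l] is taken with [N l] within [e ^+ 2] of the supremum. *)
  have [_ [l /= l0 <-] lS] : exists2 a, E a & sup E - e ^+ 2 < a.
    by apply: sup_adherent => //; rewrite exprn_gt0.
  exists (elo l p 0 i); near=> k.
  have lk : l <= k by near: k; apply: nbhs_pinfty_ge; rewrite num_real.
  have k0 : 0 < k by exact: lt_le_trans lk.
  have NS : N k <= sup E by apply: (sup_upper_bound supE); exists k.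
  have := le_trans (coord_le_dot (elo k p - elo l p) i) (dist_elo l0 lk cp).
  rewrite -/(N k) -/(N l) !mxE => le.
  rewrite /ball/= distrC -(@ltr_pXn2r _ 2)// ?nnegrE ?ltW//.
  by rewrite real_normK ?num_real//; lra.
pose x : 'rV[R]_n := \row_i lim (elo k p 0 i @[k --> +oo]).
have zx i : elo k p 0 i @[k --> +oo] --> x 0 i by rewrite mxE; exact: cv.
exists x; apply/rating_limP; split => //; rewrite /rating/=.
have cS : \sum_i elo k p 0 i @[k --> +oo] --> \sum_i x 0 i by exact: cvg_sum.
apply: (cvg_unique (@Rhausdorff R) cS).
apply: cvg_near_cst; near=> k.
by apply: elo_rating => //; near: k; exact: nbhs_pinfty_gt.
Unshelve. all: by end_near. Qed.

(** The two families differ by the reparametrisation [k * l], which tends to infinity with [l], as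
    does its inverse. *)
Lemma elo_lim_scalep k p x : 0 < k ->
  rating_lim (fun l => elo k (l *: p)) x <-> rating_lim (fun l => elo l p) x.
Proof.
move=> k0; split=> /rating_limP[rx zx]; apply/rating_limP; split => // i.
  have : (k^-1 * l) @[l --> +oo] --> +oo.
    by apply: gt0_cvgMry; [rewrite invr_gt0|exact: cvg_id].
  move=> /cvg_comp /(_ (zx i)); apply: cvg_trans; apply: near_eq_cvg.
  by apply: nearW => l; rewrite /= elo_scalep mulVKf// gt_eqF.
under eq_fun do rewrite elo_scalep.
have : (k * l) @[l --> +oo] --> +oo by apply: gt0_cvgMry => //; exact: cvg_id.
by move=> kl; have := cvg_comp _ _ kl (zx i); exact.
Qed.

Lemma zero_bounded p x : competition p -> elo_cl 1 x p = 0 ->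
  exists M, forall k, 0 < k -> norm1 (elo k p) <= M.
Proof.
(* [1 + dot x x] exceeds the square root of [dot x x], hence bounds each coordinate. *)
move=> cp x0; exists (\sum_(i < n) (1 + dot x x)) => k k0.
apply: ler_sum => i _.
have le := le_trans (coord_le_dot (elo k p) i) (elo_le_zero k0 cp x0).
move: (dot x x) (dot_ge0 x) le => d d0 le.
rewrite -(@ler_pXn2r _ 2)// ?nnegrE ?normr_ge0 ?addr_ge0//.
rewrite real_normK ?num_real// (le_trans le)//.
by nra.
Qed.

(** * Edges on directed cycles, and boundedness *)

Definition edges_back p := forall i j, edge p i j -> connect (edge p) j i.

Lemma edges_back_sym p i j : edges_back p ->
  connect (edge p) i j -> connect (edge p) j i.
Proof.
move=> back; rewrite -[connect _ j i]connect_rev.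
by apply: connect_sub => a b /back; rewrite connect_rev.
Qed.

Lemma connect_const (I : finType) (e : rel I) (T : Type) (f : I -> T) :
  (forall a b, e a b -> f a = f b) ->
  forall a b, connect e a b -> f a = f b.
Proof.
move=> ef a b /connectP[s + ->].
by elim: s a => //= c s IHs a /andP[/ef -> /IHs].
Qed.

(** No edge leaves the set reachable from [j], so a circulation cannot enter it either; the edge
    from [i] to [j] would enter it if [i] lay outside. *)
Lemma zero_edges_back p x : competition p -> elo_cl 1 x p = 0 -> edges_back p.
Proof.
move=> [p0 _] x0 i j pij; apply/negP => /negP Nji.
(* The sign makes every summand of [dot_elo_cl] nonnegative, so each one vanishes. *)
pose u : 'rV[R]_n := \row_a - (connect (edge p) j a)%:R.
have F_ge0 a b : 0 <= flow p x a b * (u 0 a - u 0 b).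
  rewrite /flow !mxE opprK [X in _ * X]addrC; have := p0 a b.
  rewrite le_eqVlt => /predU1P[<-|pab]; first by rewrite !mul0r.
  rewrite !mulr_ge0 ?(ltW (win_gt0 _)) ?(ltW pab)// subr_ge0 ler_nat.
  case: (boolP (connect _ j a)) => // ja.
  by rewrite (connect_trans ja) ?connect1.
have : dot u (elo_cl 1 x p) = 0.
  by rewrite x0 /dot big1// => a _; rewrite [X in _ * X]mxE mulr0.
rewrite dot_elo_cl.
move=> /eqP; rewrite psumr_eq0; last by move=> a _; exact: sumr_ge0.
move=> /allP/(_ i); rewrite mem_index_enum => /(_ isT)/=.
rewrite psumr_eq0// => /allP/(_ j); rewrite mem_index_enum => /(_ isT)/=.
rewrite /flow !mxE connect0 (negbTE Nji) oppr0 sub0r opprK mulr1 gt_eqF//.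
by rewrite mulr_gt0 ?win_gt0.
Qed.

(** The indicator of the set reachable from [i] is constant along edges, so its pairing with the Elo
    map is 0. *)
Lemma edges_back_sum_eq0 p k i : competition p -> 0 < k -> edges_back p ->
  \sum_(a | connect (edge p) i a) elo k p 0 a = 0.
Proof.
move=> cp k0 back.
pose u : 'rV[R]_n := \row_a (connect (edge p) i a)%:R.
have -> : \sum_(a | connect (edge p) i a) elo k p 0 a = dot u (elo k p).
  rewrite big_mkcond; apply: eq_bigr => a _; rewrite !mxE.
  by case: (connect _ i a); rewrite /= ?mul1r ?mul0r.
rewrite dot_elo// dot_elo_cl big1 ?mulr0// => a _; rewrite big1// => b _.
rewrite /flow !mxE; have [p0 _] := cp; have := p0 a b.
rewrite le_eqVlt => /predU1P[<-|pab]; first by rewrite !mul0r.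
suff -> : connect (edge p) i a = connect (edge p) i b by rewrite subrr mulr0.
apply/idP/idP => [ia|ib]; first by rewrite (connect_trans ia) ?connect1.
by rewrite (connect_trans ib) ?back.
Qed.

Lemma edge_gap_bounded p i j : competition p -> edge p i j ->
  exists M, forall k, 0 < k -> elo k p 0 j - elo k p 0 i <= M.
Proof.
move=> cp pij; have [p0 _] := cp.
(* The potential at [0]. In the energy comparison the factor [k] cancels, which makes the bound
   uniform in [k]. *)
pose C := \sum_i \sum_j p i j * softplus (0 : R).
exists (C / p i j) => k k0; rewrite ler_pdivlMr// mulrC.
apply: (@le_trans _ _ (p i j * softplus (elo k p 0 j - elo k p 0 i))).
  by rewrite ler_pM2l// softplus_ge.
have t0 a b : 0 <= p a b * softplus (elo k p 0 b - elo k p 0 a).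
  by rewrite mulr_ge0 ?softplus_ge0.
apply: (@le_trans _ _
    (\sum_a \sum_b p a b * softplus (elo k p 0 b - elo k p 0 a))).
  rewrite (bigD1 i)//= (bigD1 j)//= -addrA lerDl addr_ge0//.
    exact: sumr_ge0.
  by apply: sumr_ge0 => a _; exact: sumr_ge0.
rewrite -(ler_pM2l k0); have := energy_elo_min 0 k0 cp; rewrite /energy.
have -> : dot (0 : 'rV[R]_n) 0 = 0.
  by rewrite /dot big1// => a _; rewrite !mxE mulr0.
under [X in _ <= _ + _ * X]eq_bigr => a _ do
  under eq_bigr => b _ do rewrite !mxE subrr.
by have := dot_ge0 (elo k p); rewrite -/C; lra.
Qed.

Lemma connect_gap_bounded p i j : competition p -> connect (edge p) i j ->
  exists M, forall k, 0 < k -> elo k p 0 j - elo k p 0 i <= M.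
Proof.
move=> cp /connectP[s + ->]; elim: s i => [|a s IHs] i /=.
  by exists 0 => k _; rewrite subrr.
move=> /andP[/(edge_gap_bounded cp)[M HM] /IHs[M' HM']].
by exists (M + M') => k k0; have := HM k k0; have := HM' k k0; lra.
Qed.

Lemma edges_back_bounded p : competition p -> edges_back p ->
  exists M, forall k, 0 < k -> norm1 (elo k p) <= M.
Proof.
move=> cp back.
have /choice[M HM] (ij : 'I_n * 'I_n) : exists M, connect (edge p) ij.1 ij.2 ->
    forall k, 0 < k -> elo k p 0 ij.2 - elo k p 0 ij.1 <= M.
  have [c|_] := boolP (connect (edge p) ij.1 ij.2); last by exists 0.
  by have [M HM] := connect_gap_bounded cp c; exists M.
(* A single bound for all connected pairs. *)
pose B := \sum_ij `|M ij|.
have gap k i j : 0 < k -> connect (edge p) i j ->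
    elo k p 0 j - elo k p 0 i <= B.
  move=> k0 c; apply: le_trans (HM (i, j) c k k0) _.
  by rewrite (le_trans (ler_norm _))// /B (bigD1 (i, j))//= lerDl sumr_ge0.
exists (\sum_(i < n) B) => k k0; apply: ler_sum => i _.
have norm_le a : connect (edge p) i a -> `|elo k p 0 i - elo k p 0 a| <= B.
  move=> ia; rewrite ler_norml -lerN2 opprK opprB !gap//.
  exact: edges_back_sym.
pose S := [pred a | connect (edge p) i a].
have m0 : 0 < #|S|%:R :> R.
  by rewrite ltr0n; apply/card_gt0P; exists i; rewrite inE connect0.
have : `|\sum_(a in S) (elo k p 0 i - elo k p 0 a)| <= \sum_(a in S) B.
  by rewrite (le_trans (ler_norm_sum _ _ _))//; exact: ler_sum.
(* As the coordinates over [S] sum to 0, averaging the gaps recovers the coordinate at [i]. *)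
have -> : \sum_(a in S) (elo k p 0 i - elo k p 0 a) = #|S|%:R * elo k p 0 i.
  rewrite sumrB [X in _ - X]edges_back_sum_eq0// subr0 sumr_const.
  by rewrite mulr_natl.
by rewrite sumr_const -[B *+ _]mulr_natl normrM gtr0_norm// ler_pM2l.
Qed.

(** * Connected components and uniqueness of zeros *)

Lemma component_closed p (t : {set 'I_n}) i j : component p t -> i \in t ->
  edge p i j || edge p j i -> j \in t.
Proof.
move=> /maxsetP[/forall_inP wt tmax] it ij.
(* By maximality it suffices that adding [j] keeps [t] weakly connected; paths to and from [j] pass
   through [i]. *)
suff <- : (j |: t)%SET = t by rewrite setU11.
apply: tmax; last exact: finset.subsetUr.
pose W (s : {set 'I_n}) := [rel a b | edge_in p s a b || edge_in p s b a].
have sub a b : a \in t -> b \in t -> connect (W (j |: t)%SET) a b.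
  move=> at_ bt; have := forall_inP (wt a at_) b bt; apply: connect_sub => c d.
  move=> H; apply: connect1; move: H; rewrite /= /edge_in/=.
  by move=> /orP[]/and3P[ct dt ->]; rewrite !finset.in_setU ct dt !orbT.
have ij1 : connect (W (j |: t)%SET) i j.
  by apply: connect1; rewrite /= /edge_in/= !finset.in_setU1 eqxx it orbT.
have ji1 : connect (W (j |: t)%SET) j i.
  by apply: connect1; rewrite /= /edge_in/= !finset.in_setU1 eqxx it orbT orbC.
apply/forall_inP => a; rewrite finset.in_setU1 => /predU1P[->|at_];
  apply/forall_inP => b; rewrite finset.in_setU1 => /predU1P[->|bt].
- exact: connect0.
- exact: connect_trans ji1 (sub _ _ it bt).
- exact: connect_trans (sub _ _ at_ it) ij1.
- exact: sub.
Qed.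

(** Condition (v) without components. Directed paths starting in a component stay in it, and
    [edges_back] makes undirected paths directed. *)
Lemma components_edges_back p :
  (forall t : {set 'I_n}, component p t -> strongly_connected_on p t) <->
  edges_back p.
Proof.
split=> [strong i j ij|back t ct].
  have w1 : weakly_connected_on p [set i]%SET.
    (* The component of [i] arises by enlarging this singleton to a maximal set. *)
    by do 2!(apply/forall_inP => ? /finset.set1P ->); exact: connect0.
  have [t ct] := maxset_exists w1; rewrite finset.sub1set => it.
  have jt : j \in t by apply: (component_closed ct it); rewrite ij.
  have := forall_inP (forall_inP (strong t ct) j jt) i it.
  by apply: connect_sub => a b /and3P[_ _ ab]; exact: connect1.
have in_t a b : a \in t -> connect (edge p) a b -> connect (edge_in p t) a b.
  move=> + /connectP[s + ->]; elim: s a => [|c s IHs] a at_ /=.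
    by rewrite connect0.
  move=> /andP[ac /IHs cs]; have ct_ : c \in t.
    by apply: (component_closed ct at_); rewrite ac.
  by apply: connect_trans (cs ct_); apply: connect1; apply/and3P.
have /maxsetP[/forall_inP wt _] := ct.
apply/forall_inP => i it; apply/forall_inP => j jt.
have := forall_inP (wt i it) j jt; apply: connect_sub => a b.
move=> /orP[] /and3P[? ? ab]; apply: in_t => //; first exact: connect1.
exact: back.
Qed.

(** Two zeros give equality in [elo_cl_antitone], so [x - y] is constant along edges, hence
    everywhere; its coordinate sum 0 makes it vanish. *)
Lemma weakly_connected_zero_unique p x y :
  competition p -> weakly_connected p ->
  rating x -> elo_cl 1 x p = 0 -> rating y -> elo_cl 1 y p = 0 -> x = y.
Proof.
move=> cp wp rx x0 ry y0; have [_] := elo_cl_antitone x y cp.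
rewrite x0 y0 subr0 /dot big1 ?eqxx; last by move=> i _; rewrite mxE mul0r.
move=> /esym/forallP eqd.
have eqE a b : edge p a b -> x 0 a - y 0 a = x 0 b - y 0 b.
  by move=> ab; have /forallP/(_ b)/implyP/(_ ab)/eqP := eqd a; lra.
have cst i j : x 0 i - y 0 i = x 0 j - y 0 j.
  have := forall_inP (forall_inP wp i (finset.in_setT _)) j (finset.in_setT _).
  apply: (connect_const (f := fun a => x 0 a - y 0 a)) => a b.
  move=> /orP[] /and3P[_ _ ab]; first exact: eqE.
  by rewrite (eqE b a).
apply/rowP => i; apply/eqP; rewrite -subr_eq0.
have : \sum_j (x 0 j - y 0 j) = 0 by rewrite sumrB rx ry subrr.
under eq_bigr => j _ do rewrite (cst j i).
rewrite sumr_const card_ord => /eqP; rewrite mulrn_eq0 => /orP[/eqP n0|//].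
have n_gt0 : (0 < n)%N := leq_ltn_trans (leq0n i) (ltn_ord i).
by rewrite n0 in n_gt0.
Qed.

End EloTheory.

Theorem theorem4p8 (R : realType) (n : nat) (hn : (2 <= n)%N) (p : 'M[R]_n)
    (hp : competition p) :
  [/\ [<-> (exists x : 'rV[R]_n, rating_lim (fun k => elo k p) x);
           (forall k : R, 0 < k -> exists x : 'rV[R]_n, rating_lim (fun l => elo k (l *: p)) x);
           (exists M : R, forall k : R, 0 < k -> norm1 (elo k p) <= M);
           (exists x : 'rV[R]_n, rating x /\ elo_cl 1 x p = 0);
           (forall t : {set 'I_n}, component p t -> strongly_connected_on p t)],
      ((exists x : 'rV[R]_n, rating_lim (fun k => elo k p) x) ->
       exists x : 'rV[R]_n, [/\ rating_lim (fun k => elo k p) x,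
                     (forall k : R, 0 < k ->
                        rating_lim (fun l => elo k (l *: p)) x)
                   & elo_cl 1 x p = 0])
    & (weakly_connected p ->
       forall x y : 'rV[R]_n, rating x -> elo_cl 1 x p = 0 ->
                   rating y -> elo_cl 1 y p = 0 -> x = y)].
Proof.
split; last by move=> wp x y; exact: weakly_connected_zero_unique.
- tfae.
  + move=> [x zx] k k0; exists x; exact/elo_lim_scalep.
  (* The case [k = 1] of (ii) already gives the limit in (i), which is a zero and so bounds the
     family. *)
  + move=> /(_ 1 ltr01)[x /(elo_lim_scalep _ _ ltr01) zx].
    exact: zero_bounded hp (elo_lim_zero hp zx).
  + move=> [M zM]; have [x zx] := elo_bounded_cvg hp zM.
    by exists x; split; [case: zx|exact: elo_lim_zero].
  + move=> [x [_ x0]]; apply/components_edges_back.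
    exact: zero_edges_back x0.
  + move=> /components_edges_back back.
    have [M zM] := edges_back_bounded hp back.
    exact: elo_bounded_cvg zM.
- move=> [x zx]; exists x; split => //; last exact: elo_lim_zero.
  by move=> k k0; exact/elo_lim_scalep.
Qed.
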